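(* Let $p$ be a prime, $q=p^a$ with $a\ge 1$, and let $f(x)\in\mathbb{F}_q[x]$ have degree $d$ with $\gcd(d,p)=1$. Then for every $\lambda\in\mathbb{F}_p^\times$, \[ \mathrm{NP}(f)=\mathrm{NP}(\lambda f). \]
   Context: Let $\mathbb{Q}_q$ be the unramified extension of $\mathbb{Q}_p$ of degree $a$, with ring of integers $\mathbb{Z}_q$, and fix a primitive $p$-th root of unity $\zeta_p\in\mathbb{C}_p$. For $g(x)=\sum_{i=0}^d b_ix^i\in\mathbb{F}_q[x]$ with $\gcd(\deg g,p)=1$, let $\hat g(x)\in\mathbb{Z}_q[x]$ be obtained by replacing each coefficient by its Teichmüller lift, and for $k\ge1$ set \[ S_g^*(k)=\sum_{x}\zeta_p^{\mathrm{Tr}_{\mathbb{Q}_{q^k}/\mathbb{Q}_p}(\hat g(x))}, \] the sum running over the Teichmüller lifts $x\in\mathbb{Z}_{q^k}^\times$ of the elements of $\mathbb{F}_{q^k}^\times$. Let $L_g^*(s)=\exp\big(\sum_{k\ge1}S_g^*(k)s^k/k\big)$; it is a polynomial $\sum_{n=0}^{\deg g}c_ns^n$ of degree $\deg g$. The Newton polygon $\mathrm{NP}(g)$ is the lower convex hull of the points $(n,\mathrm{ord}_p c_n)$, $0\le n\le \deg g$, where $\mathrm{ord}_p$ is the $p$-adic valuation normalized by $\mathrm{ord}_p(p)=1$. *)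

(* Defs.v *)
From HB Require Import structures.
From mathcomp Require Import all_boot all_order all_algebra.
From mathcomp Require Import boolp classical_sets reals constructive_ereal convex.

Set Implicit Arguments.
Unset Strict Implicit.
Unset Printing Implicit Defensive.
Import Order.TTheory GRing.Theory Num.Theory.

Local Open Scope classical_set_scope.
Local Open Scope ring_scope.

Section PadicFields.
Context {R : realType} {C : closedFieldType} (ord : C -> \bar R).

Definition ord_cvg (u : nat -> C) (l : C) : Prop :=
  forall M : R, exists N : nat, forall n, (N <= n)%N ->
    (M%:E <= ord (u n - l))%E.

Definition ord_cauchy (u : nat -> C) : Prop :=
  forall M : R, exists N : nat, forall m n, (N <= m)%N -> (N <= n)%N ->
    (M%:E <= ord (u m - u n))%E.

(* The topological closure of the rational numbers. When [ord] satisfies      *)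
(* [is_Cp] below, [ord] restricts to the p-adic valuation of the rationals    *)
(* and [C] is complete, so this closure is the field of p-adic numbers.       *)
Definition Qp : set C :=
  [set x | forall M : R, exists r : rat, (M%:E <= ord (x - ratr r))%E].

Definition algebraic_Qp : set C :=
  [set x | exists P : {poly C}, [/\ P != 0, forall i, Qp P`_i & root P x]].

(* These properties characterise the completion of an algebraic closure of    *)
(* the p-adic numbers, together with its valuation, up to isomorphism.        *)
Record is_Cp (p : nat) : Prop := IsCp {
  Cp_ord0 : ord 0 = +oo%E;
  Cp_ord_fin : forall x, x != 0 -> ord x \is a fin_num;
  Cp_ordM : forall x y, ord (x * y) = (ord x + ord y)%E;
  Cp_ordD : forall x y, (Order.min (ord x) (ord y) <= ord (x + y))%E;
  Cp_ord_prime : ord p%:R = 1%:E;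
  Cp_complete : forall u, ord_cauchy u -> exists l, ord_cvg u l;
  Cp_dense : forall (x : C) (M : R),
    exists2 y, algebraic_Qp y & (M%:E <= ord (x - y))%E
}.

Definition is_Qp_basis (K : set C) (n : nat) (e : 'rV[C]_n) : Prop :=
  forall y, K y <->
    exists! c : 'cV[C]_n, (forall i, Qp (c i 0)) /\ y = (e *m c) 0 0.

Definition integers (K : set C) : set C := [set x | K x /\ (0 <= ord x)%E].

(* A finite unramified extension of the p-adic numbers inside [C], with a     *)
(* finite field presented as its residue field through the reduction map.     *)
(* Only the restriction of [ured] to the ring of integers is meaningful.      *)
(* Unramified means that the residue degree equals the degree: the residue    *)
(* field has p ^ udeg elements.                                               *)
Record unram_ext (p : nat) := UnramExt {
  ucarrier : set C;
  udeg : nat;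
  ures : finFieldType;
  ured : C -> ures;
  ucarrier_subfield :
    [/\ ucarrier 1,
        forall x y, ucarrier x -> ucarrier y -> ucarrier (x - y) &
        forall x y, ucarrier x -> ucarrier y -> ucarrier (x / y)];
  ucarrier_Qp : Qp `<=` ucarrier;
  ucarrier_basis : exists e : 'rV[C]_udeg, is_Qp_basis ucarrier e;
  ured1 : ured 1 = 1;
  uredD : forall x y, integers ucarrier x -> integers ucarrier y ->
    ured (x + y) = ured x + ured y;
  uredM : forall x y, integers ucarrier x -> integers ucarrier y ->
    ured (x * y) = ured x * ured y;
  ured_surj : forall b, exists2 x, integers ucarrier x & ured x = b;
  ured_ker : forall x, integers ucarrier x ->
    (ured x = 0 <-> (0 < ord x)%E);
  uunram : #|ures| = (p ^ udeg)%N
}.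

(* The trace of multiplication by [x] on [K], computed in any basis of [K].   *)
Definition trace_Qp (K : set C) (x : C) : C :=
  xget 0 [set t | exists (n : nat) (e : 'rV[C]_n) (M : 'M[C]_n),
    [/\ is_Qp_basis K e, forall i j, Qp (M i j), x *: e = e *m M & t = \tr M]].

Section ExponentialSums.
Context {p : nat}.

Definition teich (E : unram_ext p) (b : ures E) : C :=
  xget 0 [set t | [/\ integers (ucarrier E) t, ured E t = b &
                      t ^+ #|ures E| = t]].

Definition teich_poly (E : unram_ext p) (g : {poly ures E}) : {poly C} :=
  map_poly (teich (E := E)) g.

(* zeta ^ z for zeta ^ p = 1 and z a p-adic integer: zeta ^ n for any natural *)
(* number n congruent to z modulo p.                                          *)
Definition padic_pow (zeta z : C) : C :=
  zeta ^+ xget 0%N [set n : nat | (1%:E <= ord (z - n%:R))%E].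

Variables (zeta : C) (E : nat -> unram_ext p).

Definition expsum (g : {poly ures (E 1%N)}) (k : nat) : C :=
  \sum_(b : ures (E k) | b != 0)
    padic_pow zeta
      (trace_Qp (ucarrier (E k)) (teich_poly g).[teich b]).

(* The coefficient of s ^ n in exp (\sum_(k >= 1) S k / k s ^ k): the terms   *)
(* with k > n, and the powers of exponent j > n, do not contribute.           *)
Definition exp_coef (S : nat -> C) (n : nat) : C :=
  (\sum_(j < n.+1) (j`!%:R)^-1 *:
     (\sum_(1 <= k < n.+1) (S k / k%:R) *: 'X^k) ^+ j)`_n.

Definition Lcoef (g : {poly ures (E 1%N)}) (n : nat) : C :=
  exp_coef (expsum g) n.

Definition plane : Type := convex_lmodType (R^o * R^o)%type.

Definition convex_hull (A : set plane) : set plane :=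
  smallest (@convex_set R _) A.

Definition lower_convex_hull (A : set plane) : set plane :=
  [set P | convex_hull A P /\
           forall y : R, convex_hull A (P.1, y) -> P.2 <= y].

(* Vanishing coefficients, of infinite valuation, contribute no point.        *)
Definition NP (g : {poly ures (E 1%N)}) : set plane :=
  lower_convex_hull
    [set P | exists n : nat, [/\ (n <= (size g).-1)%N, P.1 = n%:R &
                                 ord (Lcoef g n) = (P.2)%:E]].

End ExponentialSums.
End PadicFields.

(* Main.v *)
Require Import Defs.
From HB Require Import structures.
From mathcomp Require Import all_boot all_order all_algebra.
From mathcomp Require Import boolp classical_sets reals constructive_ereal convex.
From mathcomp Require Import zify ring lra.
(** Let [w] be the Teichmuller representative of [lambda] in Z_p. The lift of
    [lambda f] is [w] times the lift of [f], and the trace is Q_p-linear, so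
    each exponential sum of [lambda f] is obtained from that of [f] by
    replacing [zeta] with [zeta ^ lambda]; hence so is each coefficient of the
    L-function, a polynomial in [zeta] with rational coefficients. This
    substitution preserves the valuation because [p] is totally ramified in
    Q(zeta): a nonzero [x = \sum_(i < p - 1) a_i (1 - zeta) ^ i] has valuation
    [min_i (ord a_i + i / (p - 1))], and [1 - zeta ^ lambda] has the same
    valuation [1 / (p - 1)] as [1 - zeta]. *)

Set Implicit Arguments.
Unset Strict Implicit.
Unset Printing Implicit Defensive.
Import Order.TTheory GRing.Theory Num.Theory.
Local Open Scope ring_scope.

(** * Valuation and p-adic numbers *)

Section Valuation.
Context (R : realType) (p : nat) (C : closedFieldType) (ord : C -> \bar R).
Context (hp : prime p) (hC : is_Cp ord p).

Lemma ord_EFin x : x != 0 -> exists r : R, ord x = r%:E.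
Proof. by move=> /(Cp_ord_fin hC) /fineK <-; eexists. Qed.

Lemma Cp_ord1 : ord 1 = 0%E.
Proof.
have [r h] := @ord_EFin 1 (oner_neq0 _).
have := Cp_ordM hC 1 1; rewrite mulr1 h => -[] ?.
by congr EFin; lra.
Qed.

Lemma Cp_ordN x : ord (- x) = ord x.
Proof.
suff h : ord (-1) = 0%E by rewrite -mulN1r (Cp_ordM hC) h add0e.
have [|r h] := @ord_EFin (-1); first by rewrite oppr_eq0 oner_neq0.
have := Cp_ordM hC (-1) (-1); rewrite mulrNN mulr1 h Cp_ord1 => -[] ?.
by congr EFin; lra.
Qed.

Lemma Cp_ordX x n : ord (x ^+ n) = (ord x *+ n)%E.
Proof.
elim: n => [|n IH]; first by rewrite expr0 Cp_ord1.
by rewrite exprS (Cp_ordM hC) IH muleS.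
Qed.

Lemma ord_geD m x y :
  (m <= ord x)%E -> (m <= ord y)%E -> (m <= ord (x + y)%R)%E.
Proof.
by move=> hx hy; apply: le_trans (Cp_ordD hC x y); rewrite le_min hx hy.
Qed.

Lemma ord_geB m x y :
  (m <= ord x)%E -> (m <= ord y)%E -> (m <= ord (x - y)%R)%E.
Proof. by move=> hx hy; apply: ord_geD => //; rewrite Cp_ordN. Qed.

Lemma ord_geMl m x y :
  (0 <= ord x)%E -> (m <= ord y)%E -> (m <= ord (x * y)%R)%E.
Proof. by move=> hx hy; rewrite (Cp_ordM hC) -[m]add0e leeD. Qed.

Lemma ord_geM0 x y :
  (0 <= ord x)%E -> (0 <= ord y)%E -> (0 <= ord (x * y)%R)%E.
Proof. exact: ord_geMl. Qed.

Lemma ord_geX0 x n : (0 <= ord x)%E -> (0 <= ord (x ^+ n)%R)%E.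
Proof.
move=> hx; elim: n => [|n IH]; first by rewrite expr0 Cp_ord1.
by rewrite exprS ord_geM0.
Qed.

Lemma ord_ge_sum m (I : Type) (r : seq I) (P : pred I) (F : I -> C) :
  (forall i, P i -> (m <= ord (F i))%E) ->
  (m <= ord (\sum_(i <- r | P i) F i)%R)%E.
Proof.
move=> h; elim/big_ind: _ => //; last exact: ord_geD.
by rewrite (Cp_ord0 hC) leey.
Qed.

Lemma ord_nat_ge0 n : (0 <= ord n%:R)%E.
Proof.
elim: n => [|n IH]; first by rewrite (Cp_ord0 hC) le0y.
by rewrite -natr1 ord_geD ?Cp_ord1.
Qed.

(** If [x + y] had larger valuation than [x], so would [x = (x + y) - y]. *)
Lemma ordD_lt x y : (ord x < ord y)%E -> ord (x + y) = ord x.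
Proof.
move=> h; apply/eqP; rewrite eq_le; apply/andP; split; last first.
  by rewrite ord_geD // ltW.
rewrite leNgt; apply/negP => h'.
have := Cp_ordD hC (x + y) (- y); rewrite addrK Cp_ordN leNgt.
by rewrite lt_min h h'.
Qed.

Lemma ordD_neq x y : ord x <> ord y -> ord (x + y) = Order.min (ord x) (ord y).
Proof.
case: (ltgtP (ord x) (ord y)) => // h _; first by rewrite ordD_lt.
by rewrite addrC ordD_lt.
Qed.

(** Bezout gives [u n = v p + 1], of valuation 0, whereas [ord n > 0] would force
    [ord (u n) > 0]. *)
Lemma ord_coprime n : coprime n p -> ord n%:R = 0%E.
Proof.
move=> h; apply/eqP; rewrite eq_le ord_nat_ge0 andbT leNgt; apply/negP => hn.
have n_gt0 : (0 < n)%N.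
  rewrite lt0n; apply: contraTneq h => ->.
  by rewrite /coprime gcd0n gtn_eqF ?prime_gt1.
have [u v huv _] := egcdnP p n_gt0.
have : (0 < ord (u * n)%:R)%E.
  rewrite natrM (Cp_ordM hC); apply: lt_le_trans hn _.
  by rewrite leeDr // ord_nat_ge0.
rewrite huv (eqP h) natrD addrC ordD_lt ?Cp_ord1 ?ltxx //.
rewrite natrM (Cp_ordM hC) (Cp_ord_prime hC).
by apply: lt_le_trans (_ : 1%:E <= _)%E; rewrite ?lte_fin ?ltr01 // leeDr ?ord_nat_ge0.
Qed.

Lemma ord_nat n : (0 < n)%N -> ord n%:R = (logn p n)%:R%:E.
Proof.
move=> n_gt0; have [m hm {1}->] := pfactor_coprime hp n_gt0.
rewrite natrM (Cp_ordM hC) natrX Cp_ordX (Cp_ord_prime hC) ord_coprime ?add0e //.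
  by rewrite -EFin_natmul.
by rewrite coprime_sym.
Qed.

Lemma Cp_natr_eq0 n : (n%:R == 0 :> C) = (n == 0%N).
Proof.
apply/eqP/eqP => [h|->//]; apply/eqP; rewrite -leqn0 leqNgt; apply/negP.
by move=> /ord_nat; rewrite h (Cp_ord0 hC).
Qed.

Lemma ord_int (m : int) : m != 0 -> exists k : nat, ord m%:~R = k%:R%:E.
Proof.
case: (intP m) => [//|n|n] _; rewrite ?mulrNz ?Cp_ordN -pmulrn;
  by rewrite ord_nat //; eexists.
Qed.

Lemma Cp_intr_eq0 (m : int) : (m%:~R == 0 :> C) = (m == 0).
Proof.
apply/eqP/eqP => [h|->//]; apply/eqP/negPn/negP => /ord_int [k].
by rewrite h (Cp_ord0 hC).
Qed.

Lemma ord_nat_ge1 n : (1%:E <= ord n%:R)%E -> (p %| n)%N.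
Proof.
apply: contraLR; rewrite -prime_coprime // coprime_sym => /ord_coprime ->.
by rewrite lee_fin ler10.
Qed.

Lemma eqn_mod_ord m n : (1%:E <= ord (m%:R - n%:R))%E -> m = n %[mod p].
Proof.
wlog le_mn : m n / (m <= n)%N => [H|].
  by have [/H//|/ltnW /H {}H] := leqP m n; rewrite -Cp_ordN opprB => /H.
rewrite -Cp_ordN opprB -natrB // => /ord_nat_ge1 h.
by apply/esym/eqP; rewrite eqn_mod_dvd.
Qed.

Lemma ord_dvdn k n : (p ^ k %| n)%N -> (k%:R%:E <= ord n%:R)%E.
Proof.
case/dvdnP => m ->; rewrite natrM natrX; apply: ord_geMl (ord_nat_ge0 _) _.
by rewrite Cp_ordX (Cp_ord_prime hC) -EFin_natmul.
Qed.

Lemma ord_natB_mod k m n :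
  m = n %[mod p ^ k] -> (k%:R%:E <= ord (m%:R - n%:R))%E.
Proof.
wlog le_mn : m n / (m <= n)%N => [H|].
  have [/H//|/ltnW /H {}H] := leqP m n.
  by move=> /esym /H; rewrite -Cp_ordN opprB.
move=> /esym /eqP; rewrite eqn_mod_dvd // => /ord_dvdn.
by rewrite natrB // -Cp_ordN opprB.
Qed.

(** Characteristic 0 of [C] comes from its valuation. Fractions need not be reduced here, so that
    [ratr] can be shown to respect sums and products. *)
Lemma ratr_frac (m n : int) : n != 0 ->
  ratr (m%:~R / n%:~R) = m%:~R / n%:~R :> C.
Proof.
move=> n0; set r := m%:~R / n%:~R.
have : (numq r * n)%:~R = (m * denq r)%:~R :> rat.
  rewrite !intrM numqE /r mulrAC mulfVK //.
  by rewrite intr_eq0.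
move/intr_inj/(congr1 (fun z : int => z%:~R : C)); rewrite !intrM => h.
rewrite /ratr; apply/eqP; rewrite eqr_div ?Cp_intr_eq0 ?denq_neq0 //.
exact/eqP.
Qed.

Lemma ratrD_C r s : ratr (r + s) = ratr r + ratr s :> C.
Proof.
have h : r + s = (numq r * denq s + numq s * denq r)%:~R / (denq r * denq s)%:~R.
  rewrite -{1}(divq_num_den r) -{1}(divq_num_den s).
  by rewrite addf_div ?intr_eq0 ?denq_neq0 // !(intrD, intrM).
rewrite h ratr_frac ?mulf_neq0 ?denq_neq0 // /ratr.
by rewrite addf_div ?Cp_intr_eq0 ?denq_neq0 // !(intrD, intrM).
Qed.

Lemma ratrN_C r : ratr (- r) = - ratr r :> C.
Proof. by rewrite /ratr numqN denqN mulrNz mulNr. Qed.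

Lemma ratrM_C r s : ratr (r * s) = ratr r * ratr s :> C.
Proof.
have h : r * s = (numq r * numq s)%:~R / (denq r * denq s)%:~R.
  rewrite -{1}(divq_num_den r) -{1}(divq_num_den s).
  by rewrite mulf_div !intrM.
rewrite h ratr_frac ?mulf_neq0 ?denq_neq0 // /ratr.
by rewrite mulf_div !intrM.
Qed.

(** Continuity of multiplication by [x]: precision [M - ord x] suffices for nonzero [x]. *)
Lemma ord_geM_ex (x : C) (M : R) : exists M' : R, forall y,
  (M'%:E <= ord y)%E -> (M%:E <= ord (x * y)%R)%E.
Proof.
have [->|/ord_EFin [r hr]] := eqVneq x 0.
  by exists 0 => y _; rewrite mul0r (Cp_ord0 hC) leey.
exists (M - r) => y hy; rewrite (Cp_ordM hC) hr.
have -> : M%:E = (r%:E + (M - r)%:E)%E by rewrite -EFinD; congr EFin; lra.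
exact: leeD.
Qed.

(** * Ring operations on the p-adic numbers *)

Lemma Qp_nat n : Qp ord n%:R.
Proof. by move=> M; exists n%:R; rewrite ratr_nat subrr (Cp_ord0 hC) leey. Qed.

Lemma QpD x y : Qp ord x -> Qp ord y -> Qp ord (x + y).
Proof.
move=> hx hy M; have [[r hr] [s hs]] := (hx M, hy M); exists (r + s).
by rewrite ratrD_C opprD addrACA ord_geD.
Qed.

Lemma QpN x : Qp ord x -> Qp ord (- x).
Proof.
by move=> hx M; have [r hr] := hx M; exists (- r); rewrite ratrN_C -opprD Cp_ordN.
Qed.

Lemma QpB x y : Qp ord x -> Qp ord y -> Qp ord (x - y).
Proof. by move=> hx hy; apply/QpD/QpN. Qed.

Lemma QpM x y : Qp ord x -> Qp ord y -> Qp ord (x * y).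
Proof.
(* The approximation [s] of [y] comes first: the precision required of [r] depends on it. *)
move=> hx hy M; have [M1 h1] := ord_geM_ex x M; have [s hs] := hy M1.
have [M2 h2] := ord_geM_ex (ratr s) M; have [r hr] := hx M2; exists (r * s).
have -> : x * y - ratr (r * s) = x * (y - ratr s) + ratr s * (x - ratr r).
  by rewrite ratrM_C; ring.
by apply: ord_geD; [apply: h1|apply: h2].
Qed.

Lemma QpX x n : Qp ord x -> Qp ord (x ^+ n).
Proof.
move=> hx; elim: n => [|n IH]; first exact: (Qp_nat 1).
by rewrite exprS; apply: QpM.
Qed.

Lemma Qp_sum (I : Type) (r : seq I) (P : pred I) (F : I -> C) :
  (forall i, P i -> Qp ord (F i)) -> Qp ord (\sum_(i <- r | P i) F i).
Proof. by move=> h; elim/big_ind: _ => //; [exact: (Qp_nat 0)|exact: QpD]. Qed.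
End Valuation.

(** * Conjugates in the cyclotomic field *)

Section Cyclotomic.
Context (R : realType) (p : nat) (C : closedFieldType) (ord : C -> \bar R).
Context (hp : prime p) (hC : is_Cp ord p).

(** Cancelling [X - 1] in the factorisation of [X^n - 1] leaves [1 + X + ... + X^(n-1)], to be
    evaluated at 1. *)
Lemma prim_root_prod_1B (F : fieldType) n (z : F) : n.-primitive_root z ->
  \prod_(1 <= i < n) (1 - z ^+ i) = n%:R.
Proof.
move=> hz; have n_gt0 := prim_order_gt0 hz.
have := factor_Xn_sub_1 hz; rewrite big_ltn // expr0 subrX1.
move/(mulfI _) => /(_ (monic_neq0 (monicXsubC _))) /(congr1 (horner^~ 1)).
rewrite horner_prod horner_sum => h.
transitivity (\sum_(i < n) ('X^i).[1 : F]).
  by rewrite -h; apply: eq_bigr => i _; rewrite hornerXsubC.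
under eq_bigr do rewrite hornerXn expr1n.
by rewrite sumr_const card_ord.
Qed.

Lemma prim_root_sum_exp (F : fieldType) n (z : F) : (1 < n)%N ->
  n.-primitive_root z -> \sum_(i < n) z ^+ i = 0.
Proof.
move=> n_gt1 hz; have /eqP := subrX1 z n; rewrite (prim_expr_order hz) subrr.
rewrite eq_sym mulf_eq0 subr_eq0 => /orP[/eqP z1|/eqP//].
by have := eq_prim_root_expr hz 1 0; rewrite z1 !expr1n eqxx mod0n modn_small.
Qed.

(** The root of unity [z] is integral, so [1 - z] divides [1 - z^i] with integral quotient. *)
Lemma ord_1B_prim_le (z : C) i : z ^+ p = 1 -> (ord (1 - z) <= ord (1 - z ^+ i)%R)%E.
Proof.
move=> hz; have z_ge0 : (0 <= ord z)%E.
  have z0 : z != 0.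
    apply/eqP => z0; move/eqP: hz.
    by rewrite z0 expr0n gtn_eqF ?prime_gt0 // eq_sym oner_eq0.
  have [r hr] := ord_EFin hC z0; have := Cp_ordX hC z p; rewrite hz (Cp_ord1 hC) hr.
  rewrite -EFin_natmul => -[] /esym /eqP; rewrite mulrn_eq0 => /orP[/eqP p0|/eqP->//].
  by move: hp; rewrite p0.
rewrite -[1 - z ^+ i]opprB subrX1 -mulNr opprB mulrC.
by apply: (ord_geMl hC) => //; apply: (ord_ge_sum hC) => j _; apply: (ord_geX0 hC).
Qed.

(** Since [z] is in turn a power of [z^i], the previous inequality holds both ways. *)
Lemma ord_1B_prim (z : C) i : p.-primitive_root z -> coprime i p ->
  ord (1 - z ^+ i) = ord (1 - z).
Proof.
move=> hz hi; apply/eqP; rewrite eq_le.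
rewrite (@ord_1B_prim_le z) ?(prim_expr_order hz) // andbT.
have hzi : p.-primitive_root (z ^+ i) by rewrite prim_root_exp_coprime.
have /(prim_rootP hzi) [j hj] : z ^+ p = 1 by rewrite prim_expr_order.
by rewrite [X in (_ <= ord (1 - X)%R)%E]hj ord_1B_prim_le ?(prim_expr_order hzi).
Qed.

(** The [p - 1] factors [1 - z^i] of [p] have equal valuations, with sum [ord p = 1]. *)
Lemma ord_1B_prim_eq (z : C) : p.-primitive_root z ->
  exists2 r : R, ord (1 - z) = r%:E & r *+ p.-1 = 1.
Proof.
move=> hz; have [|r hr] := @ord_EFin _ _ _ _ hC (1 - z).
  rewrite subr_eq0 eq_sym; apply/eqP => z1; have := eq_prim_root_expr hz 1 0.
  by rewrite z1 !expr1n eqxx mod0n modn_small ?prime_gt1.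
exists r => //; have := Cp_ord_prime hC; rewrite -(prim_root_prod_1B hz).
suff -> : ord (\prod_(1 <= i < p) (1 - z ^+ i)) = (r *+ p.-1)%:E by case.
have -> : p.-1 = (p - 1)%N by rewrite subn1.
have : (p <= p)%N by [].
(* Only the upper end of the product varies; the bound by [p] keeps every index prime to [p]. *)
elim: {1 3 4}p => [|n IH] n_lt; first by rewrite big_geq // (Cp_ord1 hC).
have [->|n_gt0] := posnP n; first by rewrite big_geq // (Cp_ord1 hC).
rewrite big_nat_recr //= (Cp_ordM hC) IH ?(ltnW n_lt) // ord_1B_prim //.
  by rewrite hr -EFinD subn1 subSS subn0 -mulrSr prednK.
by rewrite coprime_sym prime_coprime // gtnNdvd.
Qed.

(* The valuations of the nonzero terms [a_i x ^ i] are distinct modulo the    *)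
(* integers, so the sum has the valuation of its smallest term.               *)
Lemma ord_horner_eq (x y : C) (r : R) (P : {poly int}) n :
  (0 < n)%N -> r *+ n = 1 -> ord x = r%:E -> ord y = r%:E -> (size P <= n)%N ->
  ord (map_poly intr P).[x] = ord (map_poly intr P).[y].
Proof.
move=> n_gt0 hr hx hy hP.
pose t z i : C := (P`_i)%:~R * z ^+ i.
pose S k z : C := \sum_(0 <= i < k) t z i.
have S0 z : S 0%N z = 0 by rewrite /S big_geq.
have SS k z : S k.+1 z = S k z + t z k by rewrite /S big_nat_recr.
have evS z : (map_poly intr P).[z] = S n z.
  rewrite (@horner_coef_wide _ n) ?(leq_trans (size_poly _ _)) // /S big_mkord.
  by apply: eq_bigr => i _; rewrite coef_map.
rewrite !evS; clearbody S.
(* The induction also records that a finite valuation has the form [m + i r] with [i < k], which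
   separates it from that of the next term. *)
suff H k : (k <= n)%N -> ord (S k x) = ord (S k y) /\ (ord (S k x) = +oo%E \/
    exists (m i : nat), (i < k)%N /\ ord (S k x) = (m%:R + r *+ i)%:E).
  by have [] := H n (leqnn n).
elim: k => [|k IH] k_lt.
  by rewrite !S0 (Cp_ord0 hC); split=> //; left.
have [IH1 IH2] := IH (ltnW k_lt); rewrite !SS /t.
have [->|nz] := eqVneq P`_k 0.
  rewrite !mul0r !addr0; split=> //; case: IH2 => [->|[m [i [ik ->]]]]; first by left.
  by right; exists m, i; rewrite ltnS (ltnW ik).
have [l hl] := ord_int hp hC nz.
have ht (z : C) : ord z = r%:E -> ord ((P`_k)%:~R * z ^+ k) = (l%:R + r *+ k)%:E.
  by move=> hz; rewrite (Cp_ordM hC) (Cp_ordX hC) // hz hl -EFin_natmul.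
(* Equal valuations, multiplied by [n] and reduced modulo [n], would give [i = k], against
   [i < k < n]. *)
have neq : ord (S k x) <> (l%:R + r *+ k)%:E.
  case: IH2 => [->//|[m [i [ik ->]]]] [] h.
  have : (m * n + i)%:R = (l * n + k)%:R :> R.
    have e j : r *+ j * n%:R = j%:R by rewrite mulrnAl mulr_natr hr.
    by rewrite !natrD !natrM -(e i) -(e k) -!mulrDl h.
  move/eqP; rewrite eqr_nat => /eqP /(congr1 (modn^~ n)).
  by rewrite !modnMDl !modn_small ?(ltn_trans ik) // => e; rewrite e ltnn in ik.
rewrite !(ordD_neq hC) ?ht -?IH1 //; split=> //.
case: (leP (ord (S k x))) => _; last by right; exists l, k.
case: IH2 => [->|[m [i [ik ->]]]]; first by left.
by right; exists m, i; rewrite ltnS (ltnW ik).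
Qed.

Definition prime_cyclotomic : {poly int} := \poly_(i < p) 1.

Lemma prime_cyclotomic_monic : prime_cyclotomic \is monic.
Proof.
by rewrite monicE lead_coef_poly ?prime_gt0 ?oner_eq0.
Qed.

(** Division by the monic cyclotomic polynomial leaves a remainder of degree below [p - 1] with the
    same values. Expanded in powers of [1 - z], it falls under [ord_horner_eq]. *)
Lemma ord_horner_prim_root (z : C) i (P : {poly int}) :
  p.-primitive_root z -> coprime i p ->
  ord (map_poly intr P).[z] = ord (map_poly intr P).[z ^+ i].
Proof.
move=> hz hi; have hzi : p.-primitive_root (z ^+ i) by rewrite prim_root_exp_coprime.
pose Q := Pdiv.Ring.rmodp P prime_cyclotomic.
have sQ : (size Q <= p.-1)%N.
  rewrite -ltnS prednK ?prime_gt0 //.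
  apply: (@leq_trans (size prime_cyclotomic)); last exact: size_poly.
  by rewrite Pdiv.Ring.ltn_rmodp monic_neq0 ?prime_cyclotomic_monic.
have evQ (t : C) : p.-primitive_root t ->
    (map_poly intr P).[t] = (map_poly intr (Q \Po (1 - 'X))).[1 - t].
  move=> ht; rewrite map_comp_poly.
  rewrite horner_comp.
  rewrite rmorphB rmorph1 /= map_polyX !hornerE subKr.
  rewrite {1}(Pdiv.RingMonic.rdivp_eq prime_cyclotomic_monic P) -/Q.
  rewrite rmorphD rmorphM /= hornerD hornerM.
  suff -> : (map_poly intr prime_cyclotomic).[t] = 0 by rewrite mulr0 add0r.
  rewrite (@horner_coef_wide _ p) ?(leq_trans (size_poly _ _)) ?size_poly //.
  rewrite -[RHS](prim_root_sum_exp (prime_gt1 hp) ht).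
  by apply: eq_bigr => j _; rewrite coef_map coef_poly ltn_ord mul1r.
rewrite !evQ //; have [r hr r1] := ord_1B_prim_eq hz.
apply: (@ord_horner_eq _ _ r _ p.-1) => //.
- by have := prime_gt1 hp; lia.
- by rewrite ord_1B_prim.
rewrite size_comp_poly2 // -opprB size_polyN.
by rewrite -polyC1 size_XsubC.
Qed.

(* [y] is the image of [x] under [z |-> z'], for [x] a polynomial in [z] with *)
(* rational coefficients written over a common denominator.                   *)
Definition conj_prim (z z' x y : C) : Prop := exists (P : {poly int}) (N : nat),
  [/\ N != 0%N, x = (map_poly intr P).[z] / N%:R & y = (map_poly intr P).[z'] / N%:R].

Lemma ord_conj_prim z i x y : p.-primitive_root z -> coprime i p ->
  conj_prim z (z ^+ i) x y -> ord x = ord y.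
Proof.
move=> hz hi [P [N [N0 -> ->]]].
by rewrite !(Cp_ordM hC) (ord_horner_prim_root _ hz hi).
Qed.

(** * Stability of conjugacy under arithmetic operations *)

Section Closure.
Context (z z' : C).
Local Notation rel := (conj_prim z z').

Lemma conj_primX n : rel (z ^+ n) (z' ^+ n).
Proof. by exists 'X^n, 1%N; rewrite map_polyXn !hornerXn !divr1. Qed.

Lemma conj_prim0 : rel 0 0.
Proof. by exists 0, 1%N; rewrite rmorph0 !horner0 !mul0r. Qed.

Lemma conj_primD x y x' y' : rel x y -> rel x' y' -> rel (x + x') (y + y').
Proof.
move=> [P [N [N0 -> ->]]] [Q [M [M0 -> ->]]].
exists (N%:R *: Q + M%:R *: P), (N * M)%N; rewrite muln_eq0 negb_or N0 M0.
rewrite rmorphD /= !map_polyZ !rmorph_nat !hornerD !hornerZ natrM.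
by split=> //; field; rewrite !(Cp_natr_eq0 hp hC) N0 M0.
Qed.

Lemma conj_primM x y x' y' : rel x y -> rel x' y' -> rel (x * x') (y * y').
Proof.
move=> [P [N [N0 -> ->]]] [Q [M [M0 -> ->]]].
exists (P * Q), (N * M)%N; rewrite muln_eq0 negb_or N0 M0.
rewrite rmorphM /= !hornerM natrM.
by split=> //; field; rewrite !(Cp_natr_eq0 hp hC) N0 M0.
Qed.

Lemma conj_primV n : n != 0%N -> rel n%:R^-1 n%:R^-1.
Proof. by exists 1, n; rewrite rmorph1 !hornerC !div1r. Qed.

Lemma conj_prim_sum (I : Type) (r : seq I) (Q : pred I) (F G : I -> C) :
  (forall i, Q i -> rel (F i) (G i)) ->
  rel (\sum_(i <- r | Q i) F i) (\sum_(i <- r | Q i) G i).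
Proof.
move=> h; elim/big_ind2: _ => //; first exact: conj_prim0.
by move=> x y x1 y1 hx hy; apply: conj_primD.
Qed.

(** The coefficient is a polynomial in the [S k], [k > 0], with rational coefficients. *)
Lemma conj_prim_exp_coef S S' n :
  (forall k, (0 < k)%N -> rel (S k) (S' k)) -> rel (exp_coef S n) (exp_coef S' n).
Proof.
move=> h; rewrite /exp_coef !coef_sum; apply: conj_prim_sum => j _.
rewrite !coefZ; apply: conj_primM; first by apply: conj_primV; rewrite -lt0n fact_gt0.
set A := \sum_(1 <= k < n.+1) (S k / k%:R) *: 'X^k.
set B := \sum_(1 <= k < n.+1) (S' k / k%:R) *: 'X^k.
have hAB i : rel A`_i B`_i.
  rewrite /A /B !coef_sum big_nat_cond [X in rel _ X]big_nat_cond.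
  apply: conj_prim_sum => k /andP[/andP[k_gt0 _] _]; rewrite !coefZ !coefXn.
  apply: conj_primM.
    by apply: conj_primM (h _ k_gt0) (conj_primV _); rewrite -lt0n.
  by case: eqP => _; [exact: (conj_primX 0)|exact: conj_prim0].
(* Forgetting how [A] and [B] depend on [n] lets the induction on the exponent range over all
   coefficients, as the Cauchy product requires. *)
clearbody A B; move: (nat_of_ord j) => {}j; elim: j n => [|j IH] n.
  rewrite !expr0 !coef1; case: eqP => _; [exact: (conj_primX 0)|exact: conj_prim0].
by rewrite !exprS !coefM; apply: conj_prim_sum => i _; apply: conj_primM.
Qed.
End Closure.
End Cyclotomic.

(** * Teichmuller representatives *)

Section Teichmuller.
Context (R : realType) (p : nat) (C : closedFieldType) (ord : C -> \bar R).
Context (hp : prime p) (hC : is_Cp ord p).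

Lemma ord_expB_nat m x y n : (0 <= ord x)%E -> (0 <= ord y)%E ->
  (m <= ord (x - y)%R)%E -> (m <= ord (x ^+ n - y ^+ n)%R)%E.
Proof.
move=> hx hy h; rewrite subrXX mulrC; apply: (ord_geMl hC) => //.
apply: (ord_ge_sum hC) => i _.
by apply: (ord_geM0 hC); apply: (ord_geX0 hC).
Qed.

(** The cofactor of [x - y] in [x^p - y^p] is [p y^(p-1)] plus multiples of differences [x^k - y^k],
    hence has valuation at least [m]. *)
Lemma ord_expB_prime m x y : (0 <= ord x)%E -> (0 <= ord y)%E ->
  (m <= 1%:E)%E -> (m <= ord (x - y)%R)%E ->
  (ord (x - y)%R + m <= ord (x ^+ p - y ^+ p)%R)%E.
Proof.
move=> hx hy m1 h; rewrite subrXX (Cp_ordM hC) leeD2l //.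
have -> : \sum_(i < p) x ^+ (p.-1 - i) * y ^+ i =
    \sum_(i < p) (x ^+ (p.-1 - i) - y ^+ (p.-1 - i)) * y ^+ i + p%:R * y ^+ p.-1.
  rewrite mulr_natl -[in X in _ *+ X](card_ord p) -sumr_const -big_split /=.
  apply: eq_bigr => i _; rewrite mulrBl -exprD subnK ?subrK //.
  by rewrite -ltnS (ltn_predK (ltn_ord i)).
apply: (ord_geD hC); last first.
  rewrite mulrC; apply: (ord_geMl hC); first exact: (ord_geX0 hC).
  by rewrite (Cp_ord_prime hC).
apply: (ord_ge_sum hC) => i _; rewrite mulrC.
apply: (ord_geMl hC); first exact: (ord_geX0 hC).
exact: ord_expB_nat.
Qed.

(** Each further p-th power raises the bound by [m]. *)
Lemma ord_expB_prime_pow (m : \bar R) x y n : (0 <= ord x)%E -> (0 <= ord y)%E ->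
  (0 <= m)%E -> (m <= 1%:E)%E -> (m <= ord (x - y)%R)%E ->
  (ord (x - y)%R + m *+ n <= ord (x ^+ (p ^ n) - y ^+ (p ^ n))%R)%E.
Proof.
move=> hx hy m0 m1 h; elim: n => [|n IH]; first by rewrite expn0 !expr1 adde0.
rewrite muleS addeCA addeC expnSr !exprM.
apply: le_trans (ord_expB_prime _ _ m1 _); try exact: (ord_geX0 hC).
  exact: leeD2r.
exact: ord_expB_nat.
Qed.

(** The Teichmuller representative in Z_p of [l] modulo [p]. No extension is mentioned, so one [w]
    serves all the [E k]. *)
Definition teich_of (l : nat) (w : C) : Prop :=
  [/\ Qp ord w, w ^+ p = w & (1%:E <= ord (w - l%:R)%R)%E].

Lemma nat_ge (M : R) : exists N : nat, M <= N%:R.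
Proof.
exists (Num.bound `|M|); apply: le_trans (ler_norm M) _.
exact/ltW/archi_boundP.
Qed.

Lemma ord_ge_eq0 x : (forall M : R, (M%:E <= ord x)%E) -> x = 0.
Proof.
move=> h; apply/eqP/negPn/negP => /(ord_EFin hC) [r hr].
by have := h (r + 1); rewrite hr lee_fin; lra.
Qed.

Lemma teich_of_ord_ge0 l w : teich_of l w -> (0 <= ord w)%E.
Proof.
move=> [_ _ h]; rewrite -[w](subrK l%:R).
by apply: (ord_geD hC); rewrite ?(ord_nat_ge0 hC) // (le_trans _ h) // lee_fin ler01.
Qed.

(* [w] is the limit of [l ^ p ^ n]. *)
Lemma teich_of_ex l : exists w, teich_of l w.
Proof.
pose u n : C := (l ^ p ^ n)%:R.
(* Fermat's little theorem starts the estimate; each p-th power then gains 1. *)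
have uS n : (n.+1%:R%:E <= ord (u n.+1 - u n)%R)%E.
  have -> : u n.+1 - u n = (l ^ p)%:R ^+ (p ^ n) - l%:R ^+ (p ^ n).
    by rewrite /u expnS expnM !natrX.
  have h1 : (1%:E <= ord ((l ^ p)%:R - l%:R)%R)%E.
    rewrite -[1]/(1%:R); apply: (ord_natB_mod hC).
    by rewrite expn1 fermat_little.
  apply: le_trans (ord_expB_prime_pow _ _ _ _ _ h1);
    rewrite ?(ord_nat_ge0 hC) ?lee_fin ?ler01 //.
  by rewrite -EFin_natmul -natr1 addrC EFinD leeD2r.
have uD n k : (n.+1%:R%:E <= ord (u (n + k)%N - u n)%R)%E.
  elim: k => [|k IH]; first by rewrite addn0 subrr (Cp_ord0 hC) leey.
  rewrite addnS -[u _.+1](subrK (u (n + k)%N)) -addrA.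
  apply: (ord_geD hC) => //; apply: le_trans (uS _).
  by rewrite lee_fin ler_nat ltnS leq_addr.
have /(Cp_complete hC) [w hw] : ord_cauchy ord u.
  move=> M; have [N hN] := nat_ge M; exists N => m n /subnKC <- /subnKC <-.
  have {}hN : (M%:E <= N.+1%:R%:E)%E.
    by rewrite lee_fin (le_trans hN) // ler_nat.
  have -> (a b : C) : a - b = (a - u N) - (b - u N) by ring.
  by apply: (ord_geB hC); apply: le_trans hN _.
have w1 : (1%:E <= ord (w - l%:R)%R)%E.
  have [N /(_ N (leqnn N)) hN] := hw 1.
  have -> : w - l%:R = (u N - u 0%N) - (u N - w) by rewrite /u expn0 expn1; ring.
  by apply: (ord_geB hC) => //; apply: (uD 0%N).
have w0 : (0 <= ord w)%E.
  rewrite -[w](subrK l%:R); apply: (ord_geD hC); rewrite ?(ord_nat_ge0 hC) //.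
  by rewrite (le_trans _ w1) // lee_fin ler01.
exists w; split => //.
  move=> M; have [N /(_ N (leqnn N)) hN] := hw M; exists (l ^ p ^ N)%:R.
  by rewrite ratr_nat -(Cp_ordN hC) opprB.
(* As [u (N + 1) = u N ^ p], both [w] and [w^p] are limits of [u]. *)
apply/eqP; rewrite -subr_eq0; apply/eqP/ord_ge_eq0 => M.
have [N hN] := hw M.
have -> : w ^+ p - w = (u N.+1 - w) - (u N ^+ p - w ^+ p).
  by rewrite /u expnSr expnM !natrX; ring.
apply: (ord_geB hC); first exact: hN.
by apply: ord_expB_nat; [exact: (ord_nat_ge0 hC)| |exact: hN].
Qed.

Lemma teich_ofX l w n : teich_of l w -> teich_of (l ^ n) (w ^+ n).
Proof.
move=> h; have w0 := teich_of_ord_ge0 h; case: h => hw wp h; split.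
- exact: (QpX hp hC).
- by rewrite exprAC wp.
by rewrite natrX; apply: ord_expB_nat => //; exact: (ord_nat_ge0 hC).
Qed.

(** A nonzero [w] with [w^p = w] satisfies [w^(p-1) = 1]. The inverse will carry lifts, traces and
    exponents back from the scaled side. *)
Lemma teich_of_inv l w : coprime l p -> teich_of l w ->
  exists2 m, teich_of m (w ^+ p.-2) & w ^+ p.-2 * w = 1.
Proof.
move=> hl h; exists (l ^ p.-2)%N; first exact: teich_ofX.
have w0 : w != 0.
  apply/eqP => w0; case: h => _ _; rewrite w0 sub0r (Cp_ordN hC).
  by rewrite (ord_coprime hp hC hl) lee_fin ler10.
have p_gt1 := prime_gt1 hp.
apply: (mulIf w0); rewrite mul1r -!exprSr; case: h => _ wp _.
by rewrite -[RHS]wp; congr (w ^+ _); lia.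
Qed.

(** * Teichmuller lifts in an unramified extension *)

Section Lift.
Context (E : unram_ext ord p).
Local Notation K := (ucarrier E).
Local Notation OK := (integers ord K).

Lemma ucarrier0 : K 0.
Proof. by have [h1 hB _] := ucarrier_subfield E; rewrite -(subrr 1); apply: hB. Qed.

Lemma ucarrierM x y : K x -> K y -> K (x * y).
Proof.
move=> hx hy; have [h1 _ hV] := ucarrier_subfield E.
by rewrite -[y]invrK; apply: (hV) => //; rewrite -div1r; apply: hV.
Qed.

Lemma integersM x y : OK x -> OK y -> OK (x * y).
Proof. by move=> [? ?] [? ?]; split; [exact: ucarrierM|exact: (ord_geM0 hC)]. Qed.

Lemma integersB x y : OK x -> OK y -> OK (x - y).
Proof.
have [_ hB _] := ucarrier_subfield E.
by move=> [? ?] [? ?]; split; [exact: hB|exact: (ord_geB hC)].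
Qed.

Lemma integers_Qp x : Qp ord x -> (0 <= ord x)%E -> OK x.
Proof. by move=> h ?; split => //; apply: ucarrier_Qp h. Qed.

Lemma integers_nat n : OK n%:R.
Proof. by apply: integers_Qp; [exact: (Qp_nat hC)|exact: (ord_nat_ge0 hC)]. Qed.

Lemma ured0 : ured E 0 = 0.
Proof. by apply/(ured_ker (integers_nat 0)); rewrite (Cp_ord0 hC) lt0y. Qed.

Lemma ured_nat n : ured E n%:R = n%:R.
Proof.
elim: n => [|n IH]; first exact: ured0.
rewrite -!natr1 uredD ?IH ?ured1 //; first exact: integers_nat.
exact: (integers_nat 1).
Qed.

Lemma ured_eq x y : OK x -> OK y -> (ured E x = ured E y <-> (0 < ord (x - y)%R)%E).
Proof.
move=> hx hy; have hxy := integersB hx hy; rewrite -(ured_ker hxy).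
have -> : ured E x = ured E (x - y) + ured E y by rewrite -uredD // subrK.
by split=> [/eqP|->]; rewrite ?add0r // -subr_eq0 addrK => /eqP.
Qed.

Lemma ured_teich_of l w : teich_of l w -> ured E w = l%:R.
Proof.
move=> h; rewrite -ured_nat; apply/ured_eq; last first.
- by case: h => _ _; apply: lt_le_trans; rewrite lte_fin ltr01.
- exact: integers_nat.
by apply: integers_Qp (teich_of_ord_ge0 h); case: h.
Qed.

Lemma udeg_gt0 : (0 < udeg E)%N.
Proof.
rewrite lt0n; apply/eqP => h; have := uunram E; rewrite h expn0 => h1.
by have := card_finNzRing_gt1 (ures E); rewrite h1.
Qed.

Definition is_teich (b : ures E) : set C :=
  [set t | [/\ OK t, ured E t = b & t ^+ #|ures E| = t]].

(** Raising to the power [p ^ udeg E] fixes [x] and [y], yet strictly increases a finite positive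
    [ord (x - y)]. *)
Lemma is_teich_uniq b : is_subset1 (is_teich b).
Proof.
move=> x y [hx bx qx] [hy hb qy]; apply/eqP; rewrite -subr_eq0; apply/eqP.
have : (0 < ord (x - y)%R)%E by apply/ured_eq; rewrite ?bx.
set m := Order.min 1%:E (ord (x - y)) => h.
have m_gt0 : (0 < m)%E by rewrite /m lt_min lte_fin ltr01.
have := @ord_expB_prime_pow m x y (udeg E) hx.2 hy.2 (ltW m_gt0).
rewrite -uunram qx qy !ge_min !lexx orbT => /(_ isT isT) h2.
apply/eqP/negPn/negP => /(Cp_ord_fin hC) hfin.
have : (m *+ udeg E <= 0)%E.
  by rewrite -(leeD2lE _ _ hfin) adde0.
rewrite leNgt => /negP; apply.
case: (udeg E) udeg_gt0 => // n _; rewrite muleS; apply: (lt_le_trans m_gt0).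
by rewrite leeDl //; elim: n => // n IH; rewrite muleS adde_ge0 // ltW.
Qed.

Lemma is_teichM l w b t : teich_of l w -> is_teich b t -> is_teich (l%:R * b) (w * t).
Proof.
move=> hw [ht hb tq].
have w_int : OK w by apply: integers_Qp (teich_of_ord_ge0 hw); case: hw.
split; first exact: integersM.
  by rewrite uredM // hb (ured_teich_of hw).
rewrite exprMn tq uunram; congr (_ * _).
by case: hw => _ wp _; elim: (udeg E) => [|n IH]; rewrite ?expr1 // expnS exprM wp.
Qed.

Lemma teich_unique b t : is_teich b t -> teich b = t.
Proof. by move=> h; apply: xget_subset1 => //; exact: is_teich_uniq. Qed.

Lemma teich0 : teich (0 : ures E) = 0.
Proof.
apply: teich_unique; split; [exact: (integers_nat 0)|exact: ured0|].
by rewrite expr0n gtn_eqF // ltnW ?card_finNzRing_gt1.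
Qed.

Lemma ured_teich_of_inv l w m v : teich_of l w -> teich_of m v -> v * w = 1 ->
  m%:R * l%:R = 1 :> ures E.
Proof.
have int k u : teich_of k u -> OK u.
  by move=> h; apply: integers_Qp (teich_of_ord_ge0 h); case: h.
move=> hw hv vw; rewrite -(ured_teich_of hw) -(ured_teich_of hv) -uredM.
- by rewrite vw ured1.
- exact: int hv.
- exact: int hw.
Qed.

Lemma teichZ l w m v (b : ures E) : teich_of l w -> teich_of m v -> v * w = 1 ->
  teich (l%:R * b) = w * teich b.
Proof.
move=> hw hv vw; case: (pselect (exists t, is_teich b t)) => [[t ht]|hN].
  by rewrite (teich_unique ht); apply/teich_unique/is_teichM.
(* Without a lift of [b], [teich b] is the default 0. A lift of [l b] times [v] would lift [b], so
   the other side is 0 as well. *)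
rewrite [teich b]xgetPN => [|t ht]; last by apply: hN; exists t.
rewrite mulr0; apply: xgetPN => t ht; apply: hN; exists (v * t).
by have := is_teichM hv ht; rewrite mulrA (ured_teich_of_inv hw hv) // mul1r.
Qed.

Lemma teich_polyZ l w m v (g : {poly ures E}) :
  teich_of l w -> teich_of m v -> v * w = 1 ->
  teich_poly (l%:R *: g) = w *: teich_poly g.
Proof.
move=> hw hv vw; apply/polyP => i.
by rewrite coefZ !coef_map_id0 ?teich0 // coefZ (teichZ _ hw hv).
Qed.
End Lift.

(** * The trace *)

Section Trace.
Context (K : set C) (K0 : K 0).

Definition Qp_mx m n (A : 'M[C]_(m, n)) : Prop := forall i j, Qp ord (A i j).

Lemma Qp_mxM m n k (A : 'M[C]_(m, n)) (B : 'M[C]_(n, k)) :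
  Qp_mx A -> Qp_mx B -> Qp_mx (A *m B).
Proof.
move=> hA hB i j; rewrite mxE; apply: (Qp_sum hp hC) => l _.
exact: (QpM hp hC).
Qed.

Lemma Qp_mx1 n : Qp_mx (1%:M : 'M[C]_n).
Proof. by move=> i j; rewrite mxE; exact: (Qp_nat hC). Qed.

(** Uniqueness of the coordinates of 0, applied to each column of [A - B]. *)
Lemma Qp_basis_inj n (e : 'rV[C]_n) k (A B : 'M[C]_(n, k)) :
  is_Qp_basis ord K e -> Qp_mx A -> Qp_mx B -> e *m A = e *m B -> A = B.
Proof.
move=> he hA hB hAB; have [c [_ cP]] := (he 0).1 K0.
have c0 : c = 0.
  apply: cP; split=> [l|]; first by rewrite mxE; exact: (Qp_nat hC 0).
  by rewrite mulmx0 mxE.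
apply/matrixP => i j; apply/eqP; rewrite -subr_eq0.
have -> : A i j - B i j = (col j A - col j B) i 0 by rewrite !mxE.
rewrite -(cP (col j A - col j B)); first by rewrite c0 mxE.
split=> [l|].
  by rewrite !mxE; apply: (QpB hp hC).
by rewrite mulmxBr !colE !mulmxA hAB subrr mxE.
Qed.

Lemma Qp_basis_mem n (e : 'rV[C]_n) k (A : 'M[C]_(n, k)) j :
  is_Qp_basis ord K e -> Qp_mx A -> K ((e *m A) 0 j).
Proof.
move=> he hA; apply/(he _); exists (col j A); split.
  by split=> [i|]; rewrite ?mxE //; apply: eq_bigr => i _; rewrite !mxE.
move=> c [hc hjc]; apply: (Qp_basis_inj he) => //.
- by move=> i l; rewrite mxE.
- by move=> i l; rewrite ord1.
apply/matrixP => i l; rewrite !ord1 -hjc !mxE.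
by apply: eq_bigr => s _; rewrite !mxE.
Qed.

Lemma Qp_basis_change n n' (e : 'rV[C]_n) (e' : 'rV[C]_n') :
  is_Qp_basis ord K e -> is_Qp_basis ord K e' ->
  exists2 A : 'M[C]_(n, n'), Qp_mx A & e' = e *m A.
Proof.
move=> he he'.
have /choice [f hf] j : exists c : 'cV[C]_n,
    (forall i, Qp ord (c i 0)) /\ e' 0 j = (e *m c) 0 0.
  (* Taking the identity as coordinate matrix shows that the entries of [e'] lie in [K]. *)
  have := Qp_basis_mem j he' (@Qp_mx1 n'); rewrite mulmx1 => /(he _) [c [hc _]].
  by exists c.
exists (\matrix_(i, j) f j i 0) => [i j|]; first by rewrite mxE; exact: (hf j).1.
apply/matrixP => i j; rewrite ord1 (hf j).2 !mxE.
by apply: eq_bigr => s _; rewrite mxE.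
Qed.

Definition is_trace (x : C) : set C :=
  [set t | exists (n : nat) (e : 'rV[C]_n) (M : 'M[C]_n),
    [/\ is_Qp_basis ord K e, Qp_mx M, x *: e = e *m M & t = \tr M]].

(* [M' = B M A] with [A B = 1]; cyclicity of the trace holds for rectangular   *)
(* matrices, so the two bases may a priori have different sizes.               *)
Lemma is_trace_uniq x : is_subset1 (is_trace x).
Proof.
move=> _ _ [n [e [M [he hM eM ->]]]] [n' [e' [M' [he' hM' eM' ->]]]].
have [A hA eA] := Qp_basis_change he he'; have [B hB eB] := Qp_basis_change he' he.
have AB : A *m B = 1%:M.
  apply: (Qp_basis_inj he _ (@Qp_mx1 _)); first exact: Qp_mxM.
  by rewrite mulmxA -eA -eB mulmx1.
have BA : B *m A = 1%:M.
  apply: (Qp_basis_inj he' _ (@Qp_mx1 _)); first exact: Qp_mxM.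
  by rewrite mulmxA -eB -eA mulmx1.
(* Both products express [x e'] in the basis [e]. *)
have AM : A *m M' = M *m A.
  apply: (Qp_basis_inj he); try exact: Qp_mxM.
  by rewrite !mulmxA -eA -eM' -eM -scalemxAl -eA.
by rewrite -[M']mul1mx -BA -mulmxA AM mxtrace_mulC -mulmxA AB mulmx1.
Qed.

Lemma is_traceZ w x t : Qp ord w -> is_trace x t -> is_trace (w * x) (w * t).
Proof.
move=> hw [n [e [M [he hM eM ->]]]]; exists n, e, (w *: M); split => //.
- by move=> i j; rewrite mxE; apply: (QpM hp hC).
- by rewrite -scalerA eM scalemxAr.
by rewrite mxtraceZ.
Qed.

(** As for [teichZ], the inverse [v] ensures that both sides take the default 0 together. *)
Lemma trace_QpZ w v x : Qp ord w -> Qp ord v -> v * w = 1 ->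
  trace_Qp ord K (w * x) = w * trace_Qp ord K x.
Proof.
move=> hw hv vw; case: (pselect (exists t, is_trace x t)) => [[t ht]|hN].
  rewrite [trace_Qp ord K x](@xget_subset1 _ _ _ t) //; last exact: is_trace_uniq.
  by apply: xget_subset1; [exact: is_traceZ|exact: is_trace_uniq].
rewrite [trace_Qp ord K x]xgetPN => [|t ht]; last by apply: hN; exists t.
rewrite mulr0; apply: xgetPN => t ht; apply: hN; exists (v * t).
by have := is_traceZ hv ht; rewrite mulrA vw mul1r.
Qed.
End Trace.

(** * Conjugation of the exponential sums *)

Lemma padic_pow_teich_of zeta l w m v z : zeta ^+ p = 1 ->
  teich_of l w -> teich_of m v -> v * w = 1 ->
  exists n, padic_pow ord zeta z = zeta ^+ n /\
            padic_pow ord zeta (w * z) = (zeta ^+ l) ^+ n.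
Proof.
move=> hzeta hw hv vw.
pose P (y : C) := [set n : nat | (1%:E <= ord (y - n%:R)%R)%E]%classic.
(* Modulo [p], [u] is [k] and [y] is [n], so [u y] is [k n]. *)
have PM k u y n : teich_of k u -> P y n -> P (u * y) (k * n)%N.
  rewrite /P /= => hu hn; have u0 := teich_of_ord_ge0 hu; case: hu => _ _ hu.
  have -> : u * y - (k * n)%:R = u * (y - n%:R) + n%:R * (u - k%:R).
    by rewrite natrM; ring.
  by apply: (ord_geD hC); apply: (ord_geMl hC) => //; exact: (ord_nat_ge0 hC).
case: (pselect (exists n, P z n)) => [[n hn]|hN].
  exists (xget 0%N (P z)); split=> //.
  have h1 := PM _ _ _ _ hw (xgetI 0%N hn).
  have h2 := xgetI 0%N h1; rewrite /padic_pow -/(P (w * z)).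
  (* Two exponents admissible for [w z] agree modulo [p], and [zeta^p = 1]. *)
  rewrite -exprM -(expr_mod _ hzeta) -[RHS](expr_mod _ hzeta); congr (_ ^+ _).
  apply: (eqn_mod_ord hp hC).
  have -> (a b : C) : a - b = (w * z - b) - (w * z - a) by ring.
  exact: (ord_geB hC).
(* If no natural number is congruent to [z], none is congruent to [w z]: both exponents default to
   0. *)
exists 0%N; rewrite /padic_pow [xget 0%N (P z)]xgetPN => [|n hn]; last first.
  by apply: hN; exists n.
rewrite [xget _ _]xgetPN // => n hn; apply: hN; exists (m * n)%N.
by rewrite -[z]mul1r -vw -mulrA; apply: PM.
Qed.

(** Term by term, the trace is multiplied by [w], which turns [zeta^n] into [(zeta^l)^n]. *)
Lemma conj_prim_expsum zeta (E : nat -> unram_ext ord p) (f : {poly ures (E 1%N)})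
    l w m v k : zeta ^+ p = 1 -> teich_of l w -> teich_of m v -> v * w = 1 ->
  conj_prim zeta (zeta ^+ l) (expsum zeta f k) (expsum zeta (l%:R *: f) k).
Proof.
move=> hzeta hw hv vw; apply: (conj_prim_sum hp hC) => b _.
rewrite (teich_polyZ _ hw hv vw) hornerZ.
rewrite (trace_QpZ (@ucarrier0 (E k)) _ _ _ vw); [|by case: hw|by case: hv].
set z := trace_Qp _ _ _.
have [n [-> ->]] := padic_pow_teich_of z hzeta hw hv vw.
exact: conj_primX.
Qed.
End Teichmuller.

Theorem theorem1p2 (R : realType) (p a : nat) (hp : prime p) (ha : (1 <= a)%N)
    (C : closedFieldType) (ord : C -> \bar R) (hC : is_Cp ord p)
    (zeta : C) (hzeta : p.-primitive_root zeta)
    (E : nat -> unram_ext ord p)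
    (hE : forall k, (1 <= k)%N -> udeg (E k) = (a * k)%N)
    (d : nat) (f : {poly ures (E 1%N)}) (hf : size f = d.+1)
    (hd : coprime d p)
    (lambda : 'F_p) (hlambda : lambda != 0) :
  NP zeta f = NP zeta ((nat_of_ord lambda)%:R *: f).
Proof.
have hl : coprime (nat_of_ord lambda) p.
  rewrite coprime_sym prime_coprime // gtnNdvd ?lt0n //.
  by have := ltn_ord lambda; rewrite [X in (_ < X)%N]Fp_cast.
move: (nat_of_ord lambda) hl => l hl.
have [w hw] := teich_of_ex hp hC l.
have [m hv vw] := teich_of_inv hp hC hl hw.
have ordL n : ord (Lcoef zeta (l%:R *: f) n) = ord (Lcoef zeta f n).
  symmetry; apply: (ord_conj_prim hp hC hzeta hl).
  apply: (conj_prim_exp_coef hp hC) => k _.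
  exact: (conj_prim_expsum hp hC f k (prim_expr_order hzeta) hw hv vw).
(* Invertibility of [l] in the residue field makes scaling preserve the degree, hence the range of
   indices in the polygon. *)
have l0 : l%:R != 0 :> ures (E 1%N).
  apply/eqP => l0; have := ured_teich_of_inv hC (E 1%N) hw hv vw.
  by rewrite l0 mulr0 => /esym/eqP; rewrite oner_eq0.
rewrite /NP size_scale //; congr lower_convex_hull.
apply/seteqP; split=> P [n [n_le P1 P2]]; exists n; split=> //.
  by rewrite ordL.
by rewrite -ordL.
Qed.
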